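(* Let $\pi:Y\to X$ be a locally split map, $A$ a topological abelian group, and $(\mathcal U,\mathcal V)$ an admissible pair of covers for $\pi$. Then for each $\ell\ge0$ the simplicial chain complex of Čech cochains $$0\to\check C^\ell_{\mathcal U}(X;A)\xrightarrow{d}\check C^\ell_{\mathcal V}(Y;A)\xrightarrow{d}\check C^\ell_{\mathcal V^{[2]}}(Y^{[2]};A)\xrightarrow{d}\cdots$$ is exact. In particular, the collection of local sections $s:\mathrm{Et}(\mathcal U)\to Y$ belonging to the admissible pair determines a chain homotopy contraction of this complex, given by pullback along the maps of covers $\tilde s_{\ell+1}$ between $(\ell+1)$-fold intersection covers induced by the sections.
   Context: All spaces are compactly generated Hausdorff, all maps continuous. $\pi:Y\to X$ is locally split if it is surjective and has continuous sections over the members of some open cover of $X$. $Y^{[k]}$ is the $k$-fold fiber product over $X$ ($Y^{[1]}=Y$, $Y^{[0]}=X$); $\pi_j:Y^{[k+1]}\to Y^{[k]}$ omits the $j$th factor, $j=0,\dots,k$. A cover $\mathcal U$ of $X$ is an indexed family of open sets with union $X$; $\mathrm{Et}(\mathcal U)=\bigsqcup_{U\in\mathcal U}U$; $\mathcal U^{(\ell)}$ is the cover by $\ell$-fold intersections. A map of covers is a continuous map $\mathrm{Et}(\mathcal V)\to\mathrm{Et}(\mathcal U)$ taking each member into a specified member. $\check C^\ell_{\mathcal U}(X;A)=C(\mathrm{Et}(\mathcal U^{(\ell+1)});A)$, continuous maps. An admissible pair for $\pi$: covers $\mathcal U$ of $X$ and $\mathcal V$ of $Y$ with maps of covers $\tilde\pi:\mathrm{Et}(\mathcal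 V)\to\mathrm{Et}(\mathcal U)$ lifting $\pi$ and $\tilde s:\mathrm{Et}(\mathcal U)\to\mathrm{Et}(\mathcal V)$ lifting a local section $s:\mathrm{Et}(\mathcal U)\to Y$, such that $\tilde\pi\tilde s=\mathrm{Id}$ and for all $U_1,U_2\in\mathcal U$ with $U_1\cap U_2\ne\emptyset$ there is $V_2\in\mathcal V$ lying over $U_2$ with $\tilde s_{U_1}(U_1\cap U_2)\subset V_2$. Consequently there are sections $\tilde s_\ell:\mathrm{Et}(\mathcal U^{(\ell)})\to\mathrm{Et}(\mathcal V^{(\ell)})$ of $\tilde\pi$ given by $\tilde s_\ell=\tilde s_{U_1}:U_1\cap\dots\cap U_\ell\to V_1\cap\dots\cap V_\ell$. $\mathcal V^{[k]}=\mathcal V\times_{\mathcal U}\cdots\times_{\mathcal U}\mathcal V$ ($k$-fold fiber product of $\tilde\pi$) is a cover of $Y^{[k]}$, with $(\mathcal V^{[k]})^{(\ell)}\cong(\mathcal V^{(\ell)})^{[k]}$ (fiber product over $\mathcal U^{(\ell)}$); the $\pi_j$ lift to maps of covers $\mathrm{Et}((\mathcal V^{[k+1]})^{(\ell)})\to\mathrm{Et}((\mathcal V^{[k]})^{(\ell)})$, and $d=\sum_{j=0}^k(-1)^j\pi_j^*:\check C^\ell_{\mathcal V^{[k]}}(Y^{[k]};A)\to\check C^\ell_{\mathcal V^{[k+1]}}(Y^{[k+1]};A)$ (with $d=\tilde\pi^*$ for $k=0$). The sections extend to $\tilde s_\ell:\mathrm{Et}((\mathcal V^{[k-1]})^{(\ell)})\to\mathrm{Et}((\mathcal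 V^{[k]})^{(\ell)})$, $(y_0,\dots,y_{k-2})\mapsto(\tilde s_\ell(\tilde\pi(y_0)),y_0,\dots,y_{k-2})$. *)

(* Defs.v *)
From HB Require Import structures.
From mathcomp Require Import all_boot all_order all_algebra.
From mathcomp Require Import all_classical.
From mathcomp Require Import topology tvs.

Set Implicit Arguments.
Unset Strict Implicit.
Unset Printing Implicit Defensive.

Import GRing.Theory.
Local Open Scope classical_set_scope.
Local Open Scope ring_scope.

(* [O] meets every compact set in a relatively open subset.  Compactly generated
   is only used together with Hausdorff, where testing on compact subsets agrees
   with testing on maps out of compact Hausdorff spaces. *)
Definition kopen (T : topologicalType) (O : set T) : Prop :=
  forall K : set T, compact K ->
    exists2 W : set T, open W & O `&` K = W `&` K.

Definition compactly_generated (T : topologicalType) : Prop :=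
  forall O : set T, kopen O -> open O.

HB.mixin Record isCGHausdorff T & Topological T := {
  cgh_hausdorff : hausdorff_space T ;
  cgh_generated : compactly_generated T }.

#[short(type="cghType")]
HB.structure Definition CGHausdorff :=
  {T of Topological T & isCGHausdorff T}.

(* The set [T] with the topology of its k-open sets.  In the category of compactly
   generated Hausdorff spaces, limits are k-ifications of the usual ones. *)
Definition kification (T : Type) : Type := T.
Definition tok (T : Type) (x : T) : kification T := x.
Definition ofk (T : Type) (x : kification T) : T := x.

Section Kification.
Context (T : topologicalType).

HB.instance Definition _ := Choice.on (kification T).

Local Lemma kopenT : @kopen T setT.
Proof. by move=> K _; exists setT => //; exact: openT. Qed.

Local Lemma kopenI : setI_closed (@kopen T).
Proof.
move=> A B kA kB K cK; have [V oV AV] := kA K cK; have [W oW BW] := kB K cK.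
exists (V `&` W); first exact: openI.
by rewrite setIIl AV BW -setIIl.
Qed.

Local Lemma kopen_bigcup (I : Type) (f : I -> set T) :
  (forall i, kopen (f i)) -> kopen (\bigcup_i f i).
Proof.
move=> kf K cK; have /choice[W WP] i : exists W, open W /\ f i `&` K = W `&` K.
  by have [W oW fW] := kf i K cK; exists W.
exists (\bigcup_i W i); first by apply: bigcup_open => i _; have [] := WP i.
by rewrite !setI_bigcupl; apply: eq_bigcupr => i _; have [] := WP i.
Qed.

HB.instance Definition _ :=
  isOpenTopological.Build (kification T) kopenT kopenI kopen_bigcup.

Lemma kification_openE : @open (kification T) = @kopen T.
Proof. by []. Qed.

End Kification.

Lemma open_kopen (T : topologicalType) (O : set T) : open O -> kopen O.
Proof. by move=> oO K _; exists O. Qed.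

Lemma kopen_preimage (S T : topologicalType) (f : S -> T) (O : set T) :
  continuous f -> kopen O -> kopen (f @^-1` O).
Proof.
move=> cf kO K cK.
have [|W oW OW] := kO (f @` K).
  by apply: continuous_compact cK; exact: continuous_subspaceT.
exists (f @^-1` W); first by move/continuousP: cf; exact.
apply/seteqP; split=> x [Hx Kx]; split=> //=.
  by have [] : (W `&` f @` K) (f x) by rewrite -OW; split=> //; exists x.
by have [] : (O `&` f @` K) (f x) by rewrite OW; split=> //; exists x.
Qed.

Lemma continuous_from_kification (T : topologicalType) :
  continuous (@ofk T).
Proof. by apply/continuousP => O oO; exact: open_kopen. Qed.

Lemma continuous_to_kification (S T : topologicalType) (f : S -> T) :
  compactly_generated S -> continuous f ->
  continuous (@tok T \o f).
Proof.
move=> gS cf; apply/continuousP => O oO; apply: gS.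
have kO : @kopen T O by rewrite -kification_openE.
exact: (kopen_preimage cf kO).
Qed.

Lemma kification_compact (T : topologicalType) (K : set T) :
  compact K -> @compact (kification T) K.
Proof.
move=> cK F PF FK; have [p [Kp clp]] := cK F PF FK.
exists p; split=> // A B FA; rewrite nbhsE => -[O [oO Op] OB].
have kO : @kopen T O by rewrite -kification_openE.
have [W oW OW] := kO K cK.
have [|q [[Aq Kq] Wq]] := clp (A `&` K) W (filterI FA FK).
  apply: open_nbhs_nbhs; split=> //.
  by have [] : (W `&` K) p by rewrite -OW; split.
exists q; split=> //; apply: OB.
by have [] : (O `&` K) q by rewrite OW; split.
Qed.

Lemma kification_generated (T : topologicalType) :
  compactly_generated (kification T).
Proof.
move=> O kO; rewrite kification_openE => K cK.
have [W oW OW] := kO K (kification_compact cK).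
have kW : @kopen T W by rewrite -kification_openE.
by have [V oV WV] := kW K cK; exists V => //; rewrite OW.
Qed.

Lemma kification_hausdorff (T : topologicalType) :
  hausdorff_space T -> hausdorff_space (kification T).
Proof.
move=> hT p q clpq; apply: hT => A B nA nB.
by apply: clpq; exact: continuous_from_kification.
Qed.

Lemma set_type_compact (T : topologicalType) (D L : set T) :
  L `<=` D -> compact L -> compact (set_val @^-1` L : set D).
Proof.
move=> LD cL F PF FL; have [p [Lp clp]] := cL (set_val @ F) _ FL.
exists (exist _ p (mem_set (LD p Lp))); split=> // A B FA [_ [[W oW <-] Wp WB]].
have [||q [[a Aa <-] Wq]] := clp (@image (set_type D) T A set_val) W.
- by apply: (@filterS _ F) FA => a Aa; exists a.
- exact: open_nbhs_nbhs.
by exists a; split=> //; exact: WB.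
Qed.

Lemma set_type_hausdorff (T : topologicalType) (D : set T) :
  hausdorff_space T -> hausdorff_space (set_type D).
Proof.
move=> hT p q clpq; apply: val_inj; apply: hT => A B nA nB.
have [||r [Ar Br]] := clpq (set_val @^-1` A) (set_val @^-1` B).
- exact: (@initial_continuous D T set_val).
- exact: (@initial_continuous D T set_val).
by exists (set_val r).
Qed.

Lemma open_set_generated (T : topologicalType) (D : set T) :
  hausdorff_space T -> compactly_generated T -> open D ->
  compactly_generated (set_type D).
Proof.
move=> hT gT oD O kO.
suff oS : open (set_val @` O).
  exists (set_val @` O) => //; apply/seteqP; split=> [x [y Oy /val_inj <-] //|x].
  by exists x.
apply: gT => K cK.
exists (\bigcup_(N in [set N | open N /\ N `&` K `<=` set_val @` O]) N).
  by apply: bigcup_open => N [].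
apply/seteqP; split=> [x [[y Oy yx] Kx]|x [[N [oN NO] Nx] Kx]]; last first.
  by split=> //; exact: NO.
split=> //.
pose xK : set_type K := exist _ x (mem_set Kx).
have Dx : D x by rewrite -yx; exact: set_valP.
have cKT : compact [set: set_type K].
  by have := set_type_compact (@subset_refl _ K) cK;
    congr compact; apply/seteqP; split=> // z _; exact: set_valP.
have nD : nbhs xK (set_val @^-1` D).
  by apply: (@initial_continuous K T set_val); exact: open_nbhs_nbhs.
have [C nC CD] := compact_regular (set_type_hausdorff hT) cKT filterT nD.
pose L := set_val @` closure C.
have cL : compact L.
  apply: continuous_compact; last first.
    by apply: subclosed_compact cKT _ => //; exact: closed_closure.
  by apply: continuous_subspaceT; exact: (@initial_continuous K T set_val).
have LD : L `<=` D by move=> _ [z Cz <-]; exact: CD.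
have [W [V oV VW] OW] := kO _ (set_type_compact LD cL).
have /= [_ [[B oB <-] Bx BC]] := nC.
exists (B `&` V); last first.
  split; first exact: Bx.
  have [] : (W `&` set_val @^-1` L) y; last by rewrite -VW -yx.
  rewrite -OW; split=> //=; rewrite yx; exists xK => //.
  by apply: subset_closure; exact: BC.
split; first exact: openI.
move=> z [[Bz Vz] Kz].
have Lz : L z.
  exists (exist _ z (mem_set Kz)) => //.
  by apply: subset_closure; exact: BC.
exists (exist _ z (mem_set (LD z Lz))) => //.
have [] // : (O `&` set_val @^-1` L) (exist _ z (mem_set (LD z Lz))).
by rewrite OW -VW; split.
Qed.

Lemma sigT_generated (I : choiceType) (X : I -> topologicalType) :
  (forall i, compactly_generated (X i)) -> compactly_generated {i & X i}.
Proof.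
move=> gX O kO; apply/sigT_openP => i; apply: gX.
exact: kopen_preimage (@existT_continuous _ _ i) kO.
Qed.

(* A group object in compactly generated Hausdorff spaces: [A * A] carries the
   k-product topology, so this is implied by the usual joint continuity (see
   [topologicalZmod_kadd_continuous]). *)
HB.mixin Record isCGHTopologicalZmodule A & CGHausdorff A & GRing.Zmodule A := {
  kadd_continuous :
    continuous (fun x : kification (A * A) => x.1 + x.2 : A) ;
  kopp_continuous : continuous (-%R : A -> A) }.

#[short(type="cghTopZmodType")]
HB.structure Definition CGHTopologicalZmodule :=
  {A of CGHausdorff A & GRing.Zmodule A & isCGHTopologicalZmodule A}.

Lemma topologicalZmod_kadd_continuous (A : topologicalZmodType) :
  continuous (fun x : kification (A * A) => x.1 + x.2 : A).
Proof.
move=> x; apply: (@continuous_comp (kification (A * A)) (A * A)%type A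
  (@ofk _) (fun x => x.1 + x.2)).
  exact: continuous_from_kification.
exact: add_continuous.
Qed.

Section ContinuousGroup.
Context (E : cghType) (A : cghTopZmodType).

Definition cts_group : Type := continuousType E A.
HB.instance Definition _ := Choice.on cts_group.

Implicit Types f g : continuousType E A.

Local Lemma cts_add_subproof f g : continuous (fun x => f x + g x).
Proof.
move=> x.
apply: (@continuous_comp E (kification (A * A)) A
  (@tok _ \o (fun x => (f x, g x))) (fun x => x.1 + x.2)); last first.
  exact: kadd_continuous.
apply: continuous_to_kification; first exact: cgh_generated.
by move=> y; apply: cvg_pair; exact: cts_fun.
Qed.

Local Lemma cts_opp_subproof f : continuous (fun x => - f x).
Proof.
move=> x; apply: (@continuous_comp E A A f (-%R)); first exact: cts_fun.
exact: kopp_continuous.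
Qed.

Definition cts_zero : cts_group := cst 0 : continuousType E A.
Definition cts_add f g : cts_group :=
  mkcts (@cts_add_subproof f g) : continuousType E A.
Definition cts_opp f : cts_group :=
  mkcts (@cts_opp_subproof f) : continuousType E A.

Local Lemma cts_addA : associative (cts_add : cts_group -> cts_group -> _).
Proof. by move=> f g h; apply/continuousEP => x; exact: addrA. Qed.
Local Lemma cts_addC : commutative (cts_add : cts_group -> cts_group -> _).
Proof. by move=> f g; apply/continuousEP => x; exact: addrC. Qed.
Local Lemma cts_add0 :
  left_id cts_zero (cts_add : cts_group -> cts_group -> _).
Proof. by move=> f; apply/continuousEP => x; exact: add0r. Qed.
Local Lemma cts_addN : left_inverse cts_zero
  (cts_opp : cts_group -> _) (cts_add : cts_group -> cts_group -> _).
Proof. by move=> f; apply/continuousEP => x; exact: addNr. Qed.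

HB.instance Definition _ :=
  GRing.isZmodule.Build cts_group cts_addA cts_addC cts_add0 cts_addN.

End ContinuousGroup.

Section Pullback.
Context (E E' : cghType) (A : cghTopZmodType) (f : continuousType E E').

Definition pullback (c : cts_group E' A) : cts_group E A :=
  (c : continuousType E' A) \o f : continuousType E A.

Local Lemma pullback_additive : zmod_morphism pullback.
Proof. by move=> c c'; apply/continuousEP. Qed.

HB.instance Definition _ :=
  GRing.isZmodMorphism.Build (cts_group E' A) (cts_group E A) pullback
    pullback_additive.

End Pullback.

(* [open_family] does not require the members to cover: the fibre powers of the
   second cover of an admissible pair are not forced to cover the fibre powers of
   [Y] by the axioms of an admissible pair (two points of a fibre may lie only in
   members over different members of [U]). *)
Record open_family (X : topologicalType) := OpenFamily {
  fam_idx : choiceType ;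
  fam_mem :> fam_idx -> set X ;
  fam_open : forall i, open (fam_mem i) }.

Record open_cover (X : topologicalType) := OpenCover {
  cover_fam :> open_family X ;
  cover_full : \bigcup_i cover_fam i = [set: X] }.

Definition Et (X : topologicalType) (F : open_family X) : Type :=
  {i : fam_idx F & set_type (F i)}.

Section EtTopology.
Context (X : topologicalType) (F : open_family X).
HB.instance Definition _ := Topological.on (Et F).
Definition Et_idx (u : Et F) : fam_idx F := projT1 u.
Definition Et_pt (u : Et F) : X := set_val (projT2 u).

Lemma Et_ptP (u : Et F) : F (Et_idx u) (Et_pt u).
Proof. exact: set_valP. Qed.

Definition Et_mk (i : fam_idx F) (x : X) (Fx : F i x) : Et F :=
  existT (fun i => set_type (F i)) i (exist _ x (mem_set Fx)).

Lemma Et_continuous (Z : topologicalType) (f : Et F -> Z) :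
  (forall i, continuous (fun y : set_type (F i) => f (existT _ i y))) ->
  continuous f.
Proof. by move=> cf [i x] U nU; exact: cf. Qed.

Lemma Et_pt_continuous : continuous Et_pt.
Proof.
by apply: Et_continuous => i; exact: (@initial_continuous (F i) X set_val).
Qed.

Lemma Et_mk_continuous (S : topologicalType) (i : fam_idx F) (f : S -> X)
    (Ff : forall s, F i (f s)) :
  continuous f -> continuous (fun s => Et_mk (Ff s)).
Proof.
move=> cf s U nU.
have cg : continuous (fun s => exist _ (f s) (mem_set (Ff s)) : set_type (F i)).
  exact: continuous_comp_initial.
exact: cg nU.
Qed.

Lemma Et_eq (u v : Et F) : Et_idx u = Et_idx v -> Et_pt u = Et_pt v -> u = v.
Proof.
case: u v => [i x] [j y]; rewrite /Et_idx /Et_pt /= => ij; case: _ / ij y => y.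
by move=> /val_inj ->.
Qed.
End EtTopology.

Section EtCGH.
Context (X : cghType) (F : open_family X).
Local Lemma Et_hausdorff : hausdorff_space (Et F).
Proof.
by apply: sigT_hausdorff => i; apply: set_type_hausdorff; exact: cgh_hausdorff.
Qed.
Local Lemma Et_generated : compactly_generated (Et F).
Proof.
apply: sigT_generated => i; apply: open_set_generated.
- exact: cgh_hausdorff.
- exact: cgh_generated.
- exact: fam_open.
Qed.
HB.instance Definition _ :=
  isCGHausdorff.Build (Et F) Et_hausdorff Et_generated.
End EtCGH.

(* Members are indexed by all ordered tuples, repetitions included. *)
Section Inter.
Context (X : topologicalType) (F : open_family X) (l : nat).
Definition inter_mem (t : 'I_l -> fam_idx F) : set X := \bigcap_a F (t a).
Local Lemma inter_open (t : 'I_l -> fam_idx F) : open (inter_mem t).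
Proof.
rewrite openE => x Fx; have : \near x, forall a, F (t a) x.
  apply: filter_forall => a.
  by apply: open_nbhs_nbhs; split; [exact: fam_open|exact: Fx].
by apply: filterS => y Fy a _; exact: Fy.
Qed.
Definition inter : open_family X :=
  OpenFamily inter_open.
End Inter.

Record cover_map (X Y : topologicalType) (F : open_family Y)
    (G : open_family X) := CoverMap {
  cmap :> continuousType (Et F) (Et G) ;
  cmap_idx : fam_idx F -> fam_idx G ;
  cmap_idxP : forall v, Et_idx (cmap v) = cmap_idx (Et_idx v) }.

Section InducedMap.
Context (X Y : topologicalType) (f : continuousType Y X).
Context (F : open_family Y) (G : open_family X) (phi : fam_idx F -> fam_idx G).
Hypothesis fFG : forall i, F i `<=` f @^-1` (G (phi i)).

Definition induced_fun (u : Et F) : Et G :=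
  Et_mk (fFG (Et_ptP u)).

Lemma induced_continuous : continuous induced_fun.
Proof.
apply: Et_continuous => j.
apply: (@Et_mk_continuous X G (set_type (F j)) (phi j) (f \o set_val)
  (fun y => fFG (Et_ptP (existT _ j y : Et F)))) => y.
apply: continuous_comp; last exact: cts_fun.
exact: (@initial_continuous (F j) Y set_val).
Qed.

Definition induced_map : cover_map F G :=
  @CoverMap _ _ F G (mkcts induced_continuous : continuousType (Et F) (Et G)) phi
    (fun=> erefl).

End InducedMap.

(* The k-fold fibre power of [Y] over [X] as the set of (x, (y_a)_{a < k}) with
   pi y_a = x, so that k = 0 gives [X] and k = 1 gives [Y] (see
   [fiber_product0_homeo] and [fiber_product1_homeo]). *)
Section FiberProduct.
Context (X Y : cghType) (pi : Y -> X).

Definition fiber_set (k : nat) : set (X * {ptws 'I_k -> Y}) :=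
  [set p | forall a, pi (p.2 a) = p.1].
Arguments fiber_set : clear implicits.

Definition fiber_product (k : nat) : Type :=
  kification (set_type (fiber_set k)).

HB.instance Definition _ k := Topological.on (fiber_product k).

Local Lemma coord_continuous k a :
  continuous (fun p : X * {ptws 'I_k -> Y} => p.2 a).
Proof.
move=> p; apply: (@continuous_comp _ {ptws 'I_k -> Y} Y snd (@^~ a)).
  exact: cvg_snd.
exact: (@proj_continuous _ (fun=> Y)).
Qed.

Local Lemma fiber_hausdorff k : hausdorff_space (fiber_product k).
Proof.
apply: kification_hausdorff; apply: set_type_hausdorff => p q clpq.
have sep (T : topologicalType) (g : X * {ptws 'I_k -> Y} -> T) :
    hausdorff_space T -> continuous g -> g p = g q.
  by move=> hT cg; apply: hT => A B nA nB;
    have [||r [Ar Br]] := clpq (g @^-1` A) (g @^-1` B);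
    [exact: cg..|exists (g r)].
apply: injective_projections.
  by apply: (sep X fst); [exact: cgh_hausdorff|move=> ?; exact: cvg_fst].
apply/funext => a; apply: (sep Y (fun p => p.2 a)); first exact: cgh_hausdorff.
exact: coord_continuous.
Qed.
Local Lemma fiber_generated k : compactly_generated (fiber_product k).
Proof. exact: kification_generated. Qed.
HB.instance Definition _ k :=
  isCGHausdorff.Build (fiber_product k) (@fiber_hausdorff k) (@fiber_generated k).

Definition fiber_base k (y : fiber_product k) : X := (set_val (ofk y)).1.
Definition fiber_pt k (y : fiber_product k) (a : 'I_k) : Y :=
  (set_val (ofk y)).2 a.

Lemma fiberP k (y : fiber_product k) a : pi (fiber_pt y a) = fiber_base y.
Proof. exact: (set_valP (ofk y)). Qed.

Definition fiber_mk k (x : X) (y : 'I_k -> Y) (h : forall a, pi (y a) = x) :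
    fiber_product k :=
  tok (exist _ (x, y : {ptws 'I_k -> Y}) (mem_set (h : fiber_set k (x, y)))).

Lemma fiber_mk_continuous (S : topologicalType) k (x : S -> X)
  (y : S -> 'I_k -> Y) (h : forall s a, pi (y s a) = x s) :
  compactly_generated S -> continuous x -> (forall a, continuous (y^~ a)) ->
  continuous (fun s => fiber_mk (h s)).
Proof.
move=> gS cx cy; apply: continuous_to_kification => //.
have cy' : continuous (y : S -> {ptws 'I_k -> Y}).
  move=> s; apply/cvg_sup => a; apply/cvg_image.
    by apply/seteqP; split=> // z _; exists (fun=> z).
  move=> U nU; exists (fun z => U (z a)); first exact: cy.
  by apply/seteqP; split=> [z [f Uf <-] //|z Uz]; exists (fun=> z).
have cp : continuous (fun s => (x s, y s : {ptws 'I_k -> Y})).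
  move=> s; exact: (@cvg_pair _ _ _ (nbhs s) (nbhs (x s))
    (nbhs (y s : {ptws 'I_k -> Y})) _ _ _ _ _ (cx s) (cy' s)).
exact: continuous_comp_initial.
Qed.

Lemma fiber_base_continuous k : continuous (@fiber_base k).
Proof.
move=> y; apply: (@continuous_comp (fiber_product k) (set_type (fiber_set k)) X
  (@ofk _) (fst \o set_val)); first exact: continuous_from_kification.
apply: (@continuous_comp (set_type (fiber_set k)) (X * {ptws 'I_k -> Y})%type X
  set_val fst); first exact: (@initial_continuous (fiber_set k)).
exact: cvg_fst.
Qed.

Lemma fiber_pt_continuous k a : continuous (fun y => @fiber_pt k y a).
Proof.
move=> y; apply: (@continuous_comp (fiber_product k) (set_type (fiber_set k)) Y
  (@ofk _) ((fun p => p.2 a) \o set_val)); first exact: continuous_from_kification.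
apply: (@continuous_comp (set_type (fiber_set k)) (X * {ptws 'I_k -> Y})%type Y
  set_val (fun p => p.2 a)); first exact: (@initial_continuous (fiber_set k)).
exact: coord_continuous.
Qed.

End FiberProduct.

Lemma fiber_eq (X Y : cghType) (pi : Y -> X) k (y z : fiber_product pi k) :
  fiber_base y = fiber_base z -> fiber_pt y =1 fiber_pt z -> y = z.
Proof.
move=> e1 e2; apply: val_inj; apply: injective_projections; first exact: e1.
exact/funext/e2.
Qed.

Lemma fiber_product0_homeo (X Y : cghType) (pi : Y -> X) :
  exists2 g : X -> fiber_product pi 0, continuous g &
    cancel (@fiber_base X Y pi 0) g /\ cancel g (@fiber_base X Y pi 0).
Proof.
have h (x : X) (a : 'I_0) : pi (False_rect Y (notF (ltn_ord a))) = x by case: a.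
exists (fun x => fiber_mk (h x)).
  by apply: fiber_mk_continuous => [|x //|[]//]; exact: cgh_generated.
by split=> [y|//]; apply: fiber_eq => [//|[]].
Qed.

Lemma fiber_product1_homeo (X Y : cghType) (pi : continuousType Y X) :
  exists2 g : Y -> fiber_product pi 1, continuous g &
    cancel (fun y => @fiber_pt X Y pi 1 y ord0) g /\
    cancel g (fun y => @fiber_pt X Y pi 1 y ord0).
Proof.
exists (fun y => @fiber_mk X Y pi 1 (pi y) (fun=> y) (fun=> erefl)).
  by apply: fiber_mk_continuous => [|x|_ x //]; [exact: cgh_generated|exact: cts_fun].
split=> [y|//]; apply: fiber_eq => [|a]; first exact: fiberP.
by rewrite (ord1 a).
Qed.

Definition locally_split (X Y : topologicalType) (pi : Y -> X) : Prop :=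
  (forall x, exists y, pi y = x) /\
  exists U : open_cover X, forall i, exists2 s : set_type (U i) -> Y,
    continuous s & forall x, pi (s x) = set_val x.

(* [j2] indexes a member of [V] lying over [U i2] that contains the image of
   [U i1 `&` U i2] under the section [st] on [U i1]. *)
Definition section_overlap (X Y : topologicalType) (U : open_family X)
    (V : open_family Y) (pit : cover_map V U) (st : cover_map U V)
    (i1 i2 : fam_idx U) (j2 : fam_idx V) : Prop :=
  cmap_idx pit j2 = i2 /\
  forall u : Et U, Et_idx u = i1 -> U i2 (Et_pt u) -> V j2 (Et_pt (st u)).

Record admissible_pair (X Y : topologicalType) (pi : Y -> X)
    (U : open_cover X) (V : open_cover Y) := AdmissiblePair {
  adm_pi : cover_map V U ;
  adm_piE : forall v, Et_pt (adm_pi v) = pi (Et_pt v) ;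
  adm_sec : continuousType (Et U) Y ;
  adm_secK : forall u, pi (adm_sec u) = Et_pt u ;
  adm_s : cover_map U V ;
  adm_sE : forall u, Et_pt (adm_s u) = adm_sec u ;
  adm_sK : forall u, adm_pi (adm_s u) = u ;
  adm_overlap : forall i1 i2, U i1 `&` U i2 !=set0 ->
    exists j2, section_overlap adm_pi adm_s i1 i2 j2 }.

(* The choice of the members V_2 granted by [adm_overlap], needed to name the
   targets of the sections on multiple intersections. *)
Record overlap_choice (X Y : topologicalType) (pi : Y -> X)
    (U : open_cover X) (V : open_cover Y) (P : admissible_pair pi U V) := OverlapChoice {
  oc_idx :> fam_idx U -> fam_idx U -> fam_idx V ;
  oc_idxP : forall i1 i2, U i1 `&` U i2 !=set0 ->
    section_overlap (adm_pi P) (adm_s P) i1 i2 (oc_idx i1 i2) }.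

Section FiberCover.
Context (X Y : cghType) (pi : continuousType Y X) (U : open_cover X) (V : open_cover Y).
Context (P : admissible_pair pi U V).

(* An index of the k-fold fibre product of [V] over [U]: k members of [V] over a
   common member of [U]; for k = 0 this is an index of [U]. *)
Record fib_idx (k : nat) := FibIdx {
  fib_base : fam_idx U ;
  fib_pt : 'I_k -> fam_idx V ;
  fib_idxP : forall a, cmap_idx (adm_pi P) (fib_pt a) = fib_base }.

HB.instance Definition _ k := gen_eqMixin (fib_idx k).
HB.instance Definition _ k := gen_choiceMixin (fib_idx k).

Lemma fib_idx_eq k (i j : fib_idx k) :
  fib_base i = fib_base j -> fib_pt i =1 fib_pt j -> i = j.
Proof.
case: i j => [b f fP] [b' f' fP'] /= e /funext e'.
by case: _ / e fP'; case: _ / e' => fP'; rewrite (Prop_irrelevance fP fP').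
Qed.

Definition fib_mem k (i : fib_idx k) : set (fiber_product pi k) :=
  [set y | U (fib_base i) (fiber_base y) /\
           forall a, V (fib_pt i a) (fiber_pt y a)].

Local Lemma fib_open k (i : fib_idx k) : open (fib_mem i).
Proof.
rewrite openE => y [Uy Vy]; apply: filterI.
  apply: (@fiber_base_continuous X Y pi k y).
  by apply: open_nbhs_nbhs; split; [exact: fam_open|].
apply: (@filter_forall _ _ (fun a => [set z | V (fib_pt i a) (fiber_pt z a)])
  (nbhs y) _) => a; apply: (@fiber_pt_continuous X Y pi k a y).
by apply: open_nbhs_nbhs; split; [exact: fam_open|exact: Vy].
Qed.

Definition fib_family k : open_family (fiber_product pi k) :=
  OpenFamily (@fib_open k).

Section Face.
Context (l k : nat) (j : 'I_k.+1).

Definition omit_fun (y : fiber_product pi k.+1) : fiber_product pi k :=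
  fiber_mk (fun a : 'I_k => fiberP y (lift j a)).

Local Lemma omit_continuous : continuous omit_fun.
Proof.
apply: fiber_mk_continuous; first exact: cgh_generated.
  exact: fiber_base_continuous.
by move=> a; exact: fiber_pt_continuous.
Qed.

Definition omit : continuousType (fiber_product pi k.+1) (fiber_product pi k) :=
  mkcts omit_continuous.

Definition omit_idx (i : fib_idx k.+1) : fib_idx k :=
  FibIdx (fun a : 'I_k => fib_idxP i (lift j a)).

Local Lemma omit_mem (t : fam_idx (inter (fib_family k.+1) l)) :
  inter (fib_family k.+1) l t `<=`
  omit @^-1` inter (fib_family k) l (fun a => omit_idx (t a)).
Proof. by move=> y ty a _; have [Uy Vy] := ty a I; split=> // b; exact: Vy. Qed.

Definition face :
    cover_map (inter (fib_family k.+1) l) (inter (fib_family k) l) :=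
  induced_map omit_mem.

End Face.

Section InducedSection.
Context (tau : overlap_choice P) (l k : nat).

Definition fcons (T : Type) n (x : T) (f : 'I_n -> T) (a : 'I_n.+1) : T :=
  oapp f x (unlift ord0 a).

(* The targets V_1, ..., V_l+1 of the section on U_1, ..., U_l+1 given by [b]: V_1
   is the member into which the section on U_1 maps, V_a is the chosen one. *)
Definition section_idx (b : 'I_l.+1 -> fam_idx U) (a : 'I_l.+1) : fam_idx V :=
  if a == ord0 then cmap_idx (adm_s P) (b ord0) else tau (b ord0) (b a).

Lemma section_idx_over b x (Ux : forall a, U (b a) x) a :
  cmap_idx (adm_pi P) (section_idx b a) = b a.
Proof.
rewrite /section_idx; case: eqP => [->|_].
  pose u := Et_mk (Ux ord0).
  by rewrite -[RHS]/(Et_idx u) -[in RHS](adm_sK P u) !cmap_idxP.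
have /(oc_idxP tau)[//] : U (b ord0) `&` U (b a) !=set0.
by exists x; split; exact: Ux.
Qed.

Lemma section_idx_mem b x (Ux : forall a, U (b a) x) a :
  V (section_idx b a) (adm_sec P (Et_mk (Ux ord0))).
Proof.
rewrite /section_idx; case: eqP => [_|_]; rewrite -adm_sE.
  by have := Et_ptP (adm_s P (Et_mk (Ux ord0))); rewrite cmap_idxP.
have /(oc_idxP tau)[_] : U (b ord0) `&` U (b a) !=set0.
  by exists x; split; exact: Ux.
by apply=> //; exact: Ux.
Qed.

(* [tau] is only constrained at pairs with nonempty intersection, so the target
   index is built from a point [y] of the member [t]; it does not depend on it. *)
Section Point.
Context (t : 'I_l.+1 -> fib_idx k) (y : fiber_product pi k).
Hypothesis ty : inter (fib_family k) l.+1 t y.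

Lemma base_mem a : U (fib_base (t a)) (fiber_base y).
Proof. by have [] := @ty a I. Qed.

Local Lemma section_tuple_subproof a (b : 'I_k.+1) :
  cmap_idx (adm_pi P)
    (fcons (section_idx (fun a => fib_base (t a)) a) (fib_pt (t a)) b) =
  fib_base (t a).
Proof.
rewrite /fcons; case: (unlift ord0 b) => [c|] /=; first exact: fib_idxP.
exact: (section_idx_over base_mem).
Qed.

Definition section_tuple : 'I_l.+1 -> fib_idx k.+1 :=
  fun a => FibIdx (section_tuple_subproof a).

Local Lemma section_pt_subproof (b : 'I_k.+1) :
  pi (fcons (adm_sec P (Et_mk (base_mem ord0))) (fiber_pt y) b) =
  fiber_base y.
Proof.
rewrite /fcons; case: (unlift ord0 b) => [c|] /=; first exact: fiberP.
by rewrite adm_secK.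
Qed.

Definition section_pt : fiber_product pi k.+1 :=
  fiber_mk section_pt_subproof.

Lemma section_mem : inter (fib_family k.+1) l.+1 section_tuple section_pt.
Proof.
move=> a _; split; first exact: base_mem.
move=> b.
change (V (fcons (section_idx (fun a => fib_base (t a)) a) (fib_pt (t a)) b)
  (fcons (adm_sec P (Et_mk (base_mem ord0))) (fiber_pt y) b)).
rewrite /fcons; case: (unlift ord0 b) => [c|] /=; first by have [_ ] := @ty a I; apply.
exact: section_idx_mem.
Qed.
End Point.

Definition section_fun (u : Et (inter (fib_family k) l.+1)) :
    Et (inter (fib_family k.+1) l.+1) :=
  Et_mk (section_mem (Et_ptP u)).

Local Lemma section_continuous : continuous section_fun.
Proof.
apply: Et_continuous => t y0.
set F := inter (fib_family k) l.+1.
have my (y : set_type (F t)) : F t (set_val y) := set_valP y.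
have mem (y : set_type (F t)) : inter (fib_family k.+1) l.+1
    (section_tuple (my y0)) (section_pt (my y)).
  suff -> : section_tuple (my y0) = section_tuple (my y) by exact: section_mem.
  by apply/funext => a; exact: fib_idx_eq.
suff -> : (fun y => section_fun (existT (fun i => set_type (F i)) t y)) =
          (fun y => Et_mk (mem y)).
  have val_cont : continuous (set_val : set_type (F t) -> fiber_product pi k).
    exact: (@initial_continuous (F t)).
  have base_cont : continuous (fun y : set_type (F t) => fiber_base (set_val y)).
    move=> y; apply: (@continuous_comp (F t) (fiber_product pi k) X set_val
      (@fiber_base X Y pi k)); first exact: val_cont.
    exact: fiber_base_continuous.
  have sect_cont : continuous (fun y => section_pt (my y)); last first.
    by have := @Et_mk_continuous _ _ _ _ _ mem sect_cont; apply.
  apply: fiber_mk_continuous => [|//|b].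
    apply: open_set_generated; first exact: cgh_hausdorff.
      exact: cgh_generated.
    exact: fam_open.
  rewrite /fcons; case: (unlift ord0 b) => [c|] /=.
    move=> y; apply: (@continuous_comp (F t) (fiber_product pi k) Y set_val
      (fun y => @fiber_pt X Y pi k y c)); first exact: val_cont.
    exact: fiber_pt_continuous.
  move=> y; apply: continuous_comp; last exact: cts_fun.
  have := @Et_mk_continuous _ _ _ _ _
    (fun y => base_mem (my y) ord0) base_cont.
  by apply.
apply/funext => y; apply: Et_eq.
  by apply/funext => a; exact: fib_idx_eq.
apply: fiber_eq => // a.
pose u : Et F := existT _ t y.
by rewrite /section_fun (Prop_irrelevance (Et_ptP u) (my y : F (Et_idx u) (Et_pt u))).
Qed.

Definition section_map : continuousType (Et (inter (fib_family k) l.+1))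
    (Et (inter (fib_family k.+1) l.+1)) := mkcts section_continuous.

End InducedSection.
End FiberCover.

Section CechComplex.
Context (X Y : cghType) (pi : continuousType Y X) (U : open_cover X) (V : open_cover Y).
Context (P : admissible_pair pi U V) (A : cghTopZmodType) (l : nat).

Definition cech (Z : cghType) (F : open_family Z) : zmodType :=
  cts_group (Et (inter F l.+1)) A.

Definition cech_term (k : nat) : zmodType := cech (fib_family P k).

Definition cech_d_fun (k : nat) (c : cech_term k) : cech_term k.+1 :=
  \sum_(j < k.+1) pullback (face P l.+1 j) c *~ (-1) ^+ j.

Local Lemma cech_d_additive k : zmod_morphism (@cech_d_fun k).
Proof.
move=> c c'; rewrite /cech_d_fun -sumrB; apply: eq_bigr => j _.
by rewrite raddfB mulrzBl.
Qed.

HB.instance Definition _ k := GRing.isZmodMorphism.Build _ _ (@cech_d_fun k)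
  (@cech_d_additive k).

Definition cech_d k : {additive cech_term k -> cech_term k.+1} :=
  @cech_d_fun k.

Definition section_pullback (tau : overlap_choice P) k :
    {additive cech_term k.+1 -> cech_term k} :=
  pullback (section_map tau l k).

End CechComplex.

Definition exact_complex (C : nat -> zmodType)
    (d : forall k, {additive C k -> C k.+1}) : Prop :=
  (forall c, d 0%N c = 0 -> c = 0) /\ forall k c, d k.+1 c = 0 <-> exists b, d k b = c.

Definition contracting_homotopy (C : nat -> zmodType)
    (d : forall k, {additive C k -> C k.+1})
    (h : forall k, {additive C k.+1 -> C k}) : Prop :=
  (forall c, h 0%N (d 0%N c) = c) /\ forall k c, h k.+1 (d k.+1 c) + d k (h k c) = c.

(* Main.v *)
Require Import Defs.
From HB Require Import structures.
From mathcomp Require Import all_boot all_order all_algebra.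
From mathcomp Require Import all_classical.
From mathcomp Require Import topology tvs.
From mathcomp Require Import zify.

Import GRing.Theory.

(** The maps [face] and [section_map] form an augmented simplicial object with an
    extra degeneracy: [d_0 s = id] and [d_(j+1) s = s d_j].  Pulling back, every
    term of [h d] except the one for [j = 0] therefore cancels against a term of
    [d h], so [h d + d h = id]; together with [d d = 0] this gives exactness. *)

(* The bijection [(i, j) |-> (j, i - 1)] from the pairs with [j < i] to those with
   [i <= j], by which the terms of [d (d c)] cancel. *)
Lemma sum_faces_split (V : zmodType) (n : nat) (F : 'I_n.+1 -> 'I_n -> V) :
  (\sum_i \sum_j F i j =
   \sum_(i < n) \sum_(j < n | (i <= j)%N)
     (F (lift ord0 j) i + F (widen_ord (leqnSn n) i) j))%R.
Proof.
transitivity (\sum_(i < n.+1) \sum_(j < n | (j < i)%N) F i j +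
              \sum_(i < n.+1) \sum_(j < n | (i <= j)%N) F i j)%R.
  rewrite -big_split; apply: eq_bigr => i _.
  rewrite (bigID (fun j : 'I_n => (j < i)%N)) /=; congr (_ + _)%R.
  by apply: eq_bigl => j; rewrite -leqNgt.
(* The row [i = 0] of the first sum is empty, since no [j < 0], and so is the row [i = n] of the
   second. Dropping both leaves two sums over [n] rows. *)
rewrite big_ord_recl big_pred0 ?add0r // addrC big_ord_recr /=.
rewrite [X in (_ + X + _)%R]big_pred0 => [|j]; last by rewrite leqNgt ltn_ord.
(* After the shift [j < i + 1] reads [j <= i]; exchanging the two summations turns this into the
   range of the other sum. *)
rewrite addr0 addrC (exchange_big_dep xpredT) //= -big_split.
by apply: eq_bigr => i _; rewrite big_split.
Qed.

(** A cosimplicial identity: both composites enumerate, in order, the positions other than [i] and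
    [j + 1]. *)
Lemma lift_lift (n : nat) (i j : 'I_n.+1) (a : 'I_n) : (i <= j)%N ->
  lift (lift ord0 j) (lift i a) = lift (widen_ord (leqnSn n.+1) i) (lift j a).
Proof.
by move=> ij; apply: val_inj; rewrite /= /bump /=; lia.
Qed.

Lemma fcons_lift0 (T : Type) (n : nat) (x : T) (f : 'I_n -> T) (a : 'I_n) :
  fcons x f (lift ord0 a) = f a.
Proof. by rewrite /fcons liftK. Qed.

(** Omitting a position [j + 1] never touches the entry prepended at 0. In [face_section] this
    serves both for tuples of members and for tuples of points. *)
Lemma fcons_lift (T : Type) (n : nat) (x : T) (f : 'I_n.+1 -> T)
    (j : 'I_n.+1) (a : 'I_n.+1) :
  fcons x f (lift (lift ord0 j) a) = fcons x (fun b => f (lift j b)) a.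
Proof.
case: (unliftP ord0 a) => [b|] ->.
  have -> : lift (lift ord0 j) (lift ord0 b) = lift ord0 (lift j b).
    by apply: val_inj; rewrite /= /bump /= !add1n ltnS; lia.
  by rewrite !fcons_lift0.
have -> : lift (lift ord0 j) ord0 = ord0 by apply: val_inj.
by rewrite /fcons !unlift_none.
Qed.

Section Contraction.
Context (X Y : cghType) (pi : continuousType Y X).
Context (U : open_cover X) (V : open_cover Y) (P : admissible_pair pi U V).

Lemma face_face (l k : nat) (i j : 'I_k.+1) (u : Et (inter (fib_family P k.+2) l)) :
  (i <= j)%N ->
  face P l i (face P l (lift ord0 j) u) =
  face P l j (face P l (widen_ord (leqnSn k.+1) i) u).
Proof.
move=> ij; apply: Et_eq.
  apply/funext => b; apply: fib_idx_eq => // a /=.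
  by rewrite lift_lift.
apply: fiber_eq => // a.
change (fiber_pt (Et_pt u) (lift (lift ord0 j) (lift i a)) =
        fiber_pt (Et_pt u) (lift (widen_ord (leqnSn k.+1) i) (lift j a))).
by rewrite lift_lift.
Qed.

Lemma face0_section (tau : overlap_choice P) (l k : nat)
    (u : Et (inter (fib_family P k) l.+1)) :
  face P l.+1 ord0 (section_map tau l k u) = u.
Proof.
apply: Et_eq.
  by apply/funext => b; apply: fib_idx_eq => // a; exact: fcons_lift0.
apply: fiber_eq => // a.
exact: fcons_lift0.
Qed.

Lemma face_section (tau : overlap_choice P) (l k : nat) (j : 'I_k.+1)
    (u : Et (inter (fib_family P k.+1) l.+1)) :
  face P l.+1 (lift ord0 j) (section_map tau l k.+1 u) =
  section_map tau l k (face P l.+1 j u).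
Proof.
apply: Et_eq.
  by apply/funext => b; apply: fib_idx_eq => // a; exact: fcons_lift.
apply: fiber_eq => // a.
rewrite [LHS]fcons_lift.
congr (fcons _ _ a).
(* A face changes neither the base member nor the base point, so both sides evaluate the section at
   the same point of [Et U]. *)
congr (adm_sec P _); exact: Et_eq.
Qed.

Context (A : cghTopZmodType) (l : nat).

Lemma cech_dE (k : nat) (c : cech_term P A l k) :
  (cech_d P A l k c = \sum_(j < k.+1) pullback (face P l.+1 j) c *~ (-1) ^+ j)%R.
Proof. by []. Qed.

Lemma cech_dd (k : nat) (c : cech_term P A l k) :
  (cech_d P A l k.+1 (cech_d P A l k c) = 0)%R.
Proof.
rewrite cech_dE.
under eq_bigr => i _ do rewrite cech_dE raddf_sum mulrz_suml.
rewrite sum_faces_split big1 // => i _; rewrite big1 // => j ij.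
rewrite !raddfMz /= -!mulrzA.
have -> : pullback (face P l.+1 (lift ord0 j)) (pullback (face P l.+1 i) c) =
    pullback (face P l.+1 (widen_ord (leqnSn k.+1) i)) (pullback (face P l.+1 j) c).
  apply/continuousEP => u.
  by congr ((c : continuousType _ _) _); exact: face_face.
(* The paired terms carry the signs [(-1) ^+ (i + j + 1)] and [(-1) ^+ (i + j)]. *)
rewrite -mulrzDr -!exprD /bump /= add1n addnS exprS mulN1r addnC addNr.
exact: mulr0z.
Qed.

Lemma section_pullback_face0 (tau : overlap_choice P) (k : nat)
    (c : cech_term P A l k) :
  section_pullback A l tau k (pullback (face P l.+1 ord0) c) = c.
Proof.
apply/continuousEP => u.
by congr ((c : continuousType _ _) _); exact: face0_section.
Qed.

Lemma section_pullback_face (tau : overlap_choice P) (k : nat) (j : 'I_k.+1)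
    (c : cech_term P A l k.+1) :
  section_pullback A l tau k.+1 (pullback (face P l.+1 (lift ord0 j)) c) =
  pullback (face P l.+1 j) (section_pullback A l tau k c).
Proof.
apply/continuousEP => u.
by congr ((c : continuousType _ _) _); exact: face_section.
Qed.

Lemma section_pullback_contracting (tau : overlap_choice P) :
  contracting_homotopy (cech_d P A l) (section_pullback A l tau).
Proof.
split=> [c|k c].
  by rewrite cech_dE big_ord1 expr0 mulr1z section_pullback_face0.
rewrite !cech_dE big_ord_recl expr0 mulr1z raddfD raddf_sum.
rewrite section_pullback_face0 -addrA -big_split big1 ?addr0 //= => j _.
rewrite raddfMz section_pullback_face -mulrzDr /bump add1n exprS mulN1r addNr.
exact: mulr0z.
Qed.

Lemma overlap_choice_inhabited : inhabited (overlap_choice P).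
Proof.
have /choice[tau tauP] (i : fam_idx U * fam_idx U) : exists j,
    (U i.1 `&` U i.2 !=set0)%classic ->
    section_overlap (adm_pi P) (adm_s P) i.1 i.2 j.
  have [/(adm_overlap P)[j jP]|no] := pselect (U i.1 `&` U i.2 !=set0)%classic.
    by exists j.
  (* Over an empty intersection nothing is required; this index is a default value. *)
  by exists (cmap_idx (adm_s P) i.1).
constructor; exists (fun i1 i2 => tau (i1, i2)) => i1 i2.
exact: (tauP (i1, i2)).
Qed.

End Contraction.

Theorem proposition2p3 (X Y : cghType) (pi : continuousType Y X)
    (pi_split : locally_split pi) (A : cghTopZmodType)
    (U : open_cover X) (V : open_cover Y) (P : admissible_pair pi U V) (l : nat) :
  exact_complex (cech_d P A l) /\
  inhabited (overlap_choice P) /\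
  forall tau : overlap_choice P,
    contracting_homotopy (cech_d P A l) (section_pullback A l tau).
Proof.
have [tau] := overlap_choice_inhabited _ _ _ _ _ P.
have [h0 hS] := section_pullback_contracting _ _ _ _ _ P A l tau.
split; last first.
  by split=> [|tau']; [constructor|exact: section_pullback_contracting].
split=> [c dc0|k c]; first by rewrite -[c]h0 dc0 raddf0.
split=> [dc0|[b <-]]; last exact: cech_dd.
(* For a cocycle [c] the term [h (d c)] vanishes, so the homotopy identity reads [d (h c) = c]. *)
by exists (section_pullback A l tau k c); rewrite -[RHS]hS dc0 raddf0 add0r.
Qed.
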